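(* There are absolute constants $\kappa_1,\dots,\kappa_5>0$ such that the following holds. For every $n\in\mathbb{N}$, every $\delta\in(0,1)$ and every $\varepsilon$ with $\frac{\kappa_2\log(1/\delta)}{n}\le\varepsilon\le 1$, there exists $\lambda=\lambda(n,\varepsilon,\delta)$ such that the bit-sum protocol $P_{n,\lambda}$ is $(\varepsilon,\delta)$-differentially private in the shuffled model and \[ \lambda\le\begin{cases}\dfrac{\kappa_4\log(1/\delta)}{\varepsilon^2} & \text{if } \varepsilon\ge\sqrt{\dfrac{\kappa_3\log(1/\delta)}{n}},\\[2mm] n-\dfrac{\kappa_5\,\varepsilon\, n^{3/2}}{\sqrt{\log(1/\delta)}} & \text{otherwise.}\end{cases} \]
   Context: An algorithm $M$ on datasets $X=(x_1,\dots,x_n)\in\mathcal{X}^n$ is $(\varepsilon,\delta)$-differentially private if for all neighboring datasets $X\sim X'$ (differing in at most one user's entry) and every set $T$ of outputs, $\Pr[M(X)\in T]\le e^{\varepsilon}\Pr[M(X')\in T]+\delta$. In the shuffled model, each of $n$ users applies a randomized encoder $R$ to its datum and sends the resulting message(s) to a shuffler $S$, which outputs all messages in a uniformly random order; an analyzer $A$ then processes the shuffled messages. A protocol $(R,S,A)$ is $(\varepsilon,\delta)$-differentially private in the shuffled model if the map $(x_1,\dots,x_n)\mapsto S(R(x_1),\dots,R(x_n))$ is $(\varepsilon,\delta)$-differentially private. The bit-sum protocol $P_{n,\lambda}=(R_{n,\lambda},S,A_{n,\lambda})$, for $n$ users with $x_i\in\{0,1\}$ and parameter $\lambda\in(0,n)$: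 each user independently draws $b\sim\mathrm{Ber}(\lambda/n)$ and sends the single bit $y=x_i$ if $b=0$ and $y\sim\mathrm{Ber}(1/2)$ (fresh uniform bit) if $b=1$; the analyzer outputs $\frac{n}{n-\lambda}\left(\sum_{i=1}^n y_i-\frac{\lambda}{2}\right)$. Here $\log$ is the natural logarithm. *)

(* Defs.v *)
From Stdlib Require Import Reals.
From HB Require Import structures.
From mathcomp Require Import all_boot all_order all_algebra all_fingroup.
From mathcomp Require Import Rstruct.
Set Implicit Arguments. Unset Strict Implicit. Unset Printing Implicit Defensive.
Import Order.TTheory GRing.Theory Num.Theory.
Local Open Scope ring_scope.

(* Probability that the local randomizer R_{n,lambda} sends bit y on input x:
   with prob. 1 - lambda/n (b = 0) it sends x, with prob. lambda/n (b = 1)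
   it sends a fresh uniform bit. *)
Definition msg_prob (n : nat) (lam : R) (x y : bool) : R :=
  (1 - lam / n%:R) * (y == x)%:R + (lam / n%:R) / 2.

(* Output distribution of S(R(x_1),...,R(x_n)): the shuffler outputs
   z with z_(s i) = y_i for a uniformly random permutation s of 'I_n. *)
Definition shuffled_bitsum_prob (n : nat) (lam : R)
    (X z : {ffun 'I_n -> bool}) : R :=
  (n`!%:R)^-1 * \sum_(s : 'S_n) \prod_(i < n) msg_prob n lam (X i) (z (s i)).

Definition prob_event (n : nat) (lam : R) (X : {ffun 'I_n -> bool})
    (T : {set {ffun 'I_n -> bool}}) : R :=
  \sum_(z in T) shuffled_bitsum_prob lam X z.

Definition neighboring (n : nat) (X X' : {ffun 'I_n -> bool}) : Prop :=
  (#|[set i | X i != X' i]| <= 1)%N.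

Definition bitsum_shuffled_DP (n : nat) (lam eps delta : R) : Prop :=
  forall X X' : {ffun 'I_n -> bool}, neighboring X X' ->
  forall T : {set {ffun 'I_n -> bool}},
    prob_event lam X T <= exp eps * prob_event lam X' T + delta.

(* Main.v *)
(* After shuffling, an event depends only on the number of ones sent, whose
   probability generating function is the product over the users of
   [q X^x + (1 - q) (1 + X) / 2], where [q = 1 - lam / n]. Expanding the product
   over the users other than the differing one gives a mixture of shifts of
   [((1 + X) / 2)^s], [s] being the number of randomised users, so one compares
   Bin(s, 1/2) with its translate by 1. The ratio of consecutive binomial
   coefficients exceeds [1 + a] only in a tail, and a Chernoff weight bounds that
   tail by [e * t^s] with [t = 1 - a^2 / 50]; such a bound averages over [s]
   exactly, to [e * (q + (1 - q) t)^(n - 1)]. The differing user's own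
   randomisation finally replaces the slack [a] by [2 q a], which is what makes
   the regime of [lam] close to [n] work. When [delta] is close to 1, the total
   variation bound [1/2 + 0^s/2] is used in place of the Chernoff bound. *)
Require Import Defs.
From Stdlib Require Import Reals.
From HB Require Import structures.
From mathcomp Require Import all_boot all_order all_algebra all_fingroup.
From mathcomp Require Import Rstruct.
From mathcomp Require Import ring lra.
Import Order.TTheory GRing.Theory Num.Theory.
Local Open Scope ring_scope.

(** * Generating functions of bit counts and closeness to their translates *)

(* The expectation of [g] at a variable with generating function [P], as soon
   as [size P <= N]. *)
Definition weighted_coefs {F : realFieldType} (N : nat) (g : nat -> F)
    (P : {poly F}) : F :=
  \sum_(k < N) P`_k * g k.

Lemma weighted_coefsD {F : realFieldType} N (g : nat -> F) (P Q : {poly F}) :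
  weighted_coefs N g (P + Q) = weighted_coefs N g P + weighted_coefs N g Q.
Proof.
by rewrite -big_split; apply: eq_bigr => k _; rewrite coefD mulrDl.
Qed.

Lemma weighted_coefsZ {F : realFieldType} N (g : nat -> F) (a : F)
    (P : {poly F}) :
  weighted_coefs N g (a *: P) = a * weighted_coefs N g P.
Proof.
by rewrite mulr_sumr; apply: eq_bigr => k _; rewrite coefZ mulrA.
Qed.

Lemma weighted_coefs0n {F : realFieldType} (g : nat -> F) (P : {poly F}) :
  weighted_coefs 0 g P = 0.
Proof. exact: big_ord0. Qed.

Lemma weighted_coefsXM {F : realFieldType} N (g : nat -> F) (P : {poly F}) :
  weighted_coefs N.+1 g ('X * P) = weighted_coefs N (g \o succn) P.
Proof.
rewrite /weighted_coefs big_ord_recl coefXM mul0r add0r.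
by apply: eq_bigr => k _; rewrite coefXM.
Qed.

Lemma weighted_coefs_ge0 {F : realFieldType} N (g : nat -> F) (P : {poly F}) :
  (forall k, 0 <= P`_k) -> (forall k, 0 <= g k <= 1) ->
  0 <= weighted_coefs N g P.
Proof.
move=> P_ge0 g01; apply: sumr_ge0 => k _.
by rewrite mulr_ge0 //; case/andP: (g01 k).
Qed.

Definition fair_bit {F : realFieldType} : {poly F} := 2^-1 *: (1 + 'X).

Definition msg_poly {F : realFieldType} (q : F) (x : bool) : {poly F} :=
  q *: 'X^x + (1 - q) *: fair_bit.

(** Test functions valued in [[0, 1]] replace events, as shuffling turns an event into a fractional
    weight on the count. Both directions are kept since either neighbour may hold the extra one;
    quantifying over [N] lets a factor ['X] be absorbed into [g]. *)
Definition shift_close {F : realFieldType} (c B : F) (P : {poly F}) : Prop :=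
  forall N (g : nat -> F), (forall k, 0 <= g k <= 1) ->
    weighted_coefs N g P <= c * weighted_coefs N g ('X * P) + B /\
    weighted_coefs N g ('X * P) <= c * weighted_coefs N g P + B.

Lemma shift_close_mix {F : realFieldType} (c q B1 B2 : F) (P1 P2 : {poly F}) :
  0 <= q <= 1 ->
  shift_close c B1 P1 -> shift_close c B2 P2 ->
  shift_close c (q * B1 + (1 - q) * B2) (q *: P1 + (1 - q) *: P2).
Proof.
move=> /andP[q0 q1] h1 h2 N g g01.
have [a1 b1] := h1 N g g01; have [a2 b2] := h2 N g g01.
rewrite mulrDr -!scalerAr !weighted_coefsD !weighted_coefsZ.
have q'0 : 0 <= 1 - q by lra.
have := ler_wpM2l q0 a1; have := ler_wpM2l q'0 a2.
have := ler_wpM2l q0 b1; have := ler_wpM2l q'0 b2.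
by split; lra.
Qed.

Lemma shift_close_mulXn {F : realFieldType} (c B : F) (P : {poly F}) k :
  shift_close c B P -> shift_close c B ('X^k * P).
Proof.
move=> cP; elim: k => [|k IHk]; first by rewrite mul1r.
case=> [|N] g g01; first by have := cP 0 g g01; rewrite !weighted_coefs0n.
rewrite exprS -mulrA !weighted_coefsXM.
by apply: IHk => j; apply: g01.
Qed.

(* Each message is kept with probability [q] and replaced by a fair bit
   otherwise; bounds of the form [A * t ^ s + B] on the number [s] of fair bits
   are stable under this mixture. *)
Lemma shift_close_msgs {F : realFieldType} (c A t B q : F) (xs : seq bool) :
  0 <= q <= 1 ->
  (forall s, shift_close c (A * t ^+ s + B) (fair_bit ^+ s)) ->
  forall s, shift_close c (A * t ^+ s * (q + (1 - q) * t) ^+ size xs + B)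
    ((\prod_(x <- xs) msg_poly q x) * fair_bit ^+ s).
Proof.
move=> q01 base; elim: xs => [|x xs IHxs] s.
  by rewrite big_nil mul1r mulr1.
rewrite big_cons /msg_poly -/(msg_poly q).
set Q := \prod_(y <- xs) msg_poly q y.
have -> : (q *: 'X^x + (1 - q) *: fair_bit) * Q * fair_bit ^+ s =
  q *: ('X^x * (Q * fair_bit ^+ s)) + (1 - q) *: (Q * fair_bit ^+ s.+1).
  by rewrite exprS [Q * (fair_bit * _)]mulrCA !mulrDl -!mulrA -!scalerAl.
set C := A * _ * _ + B.
have -> : C = q * (A * t ^+ s * (q + (1 - q) * t) ^+ size xs + B)
  + (1 - q) * (A * t ^+ s.+1 * (q + (1 - q) * t) ^+ size xs + B).
  by rewrite /C /= !exprS; ring.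
apply: shift_close_mix => //; exact: shift_close_mulXn.
Qed.

(** * The fair binomial against its translate *)

Lemma fair_bitXS {F : realFieldType} s : fair_bit ^+ s.+1 =
  (2^-1 : F) *: fair_bit ^+ s + 2^-1 *: ('X * fair_bit ^+ s).
Proof. by rewrite exprS /fair_bit -scalerAl mulrDl mul1r scalerDr. Qed.

Lemma weighted_coefs_fair_bitX {F : realFieldType} s N (g : nat -> F) :
  (forall k, 0 <= g k <= 1) ->
  0 <= weighted_coefs N g (fair_bit ^+ s) <= 1.
Proof.
elim: s N g => [|s IHs] [|N] g g01; rewrite ?weighted_coefs0n ?lexx ?ler01 //.
  rewrite /weighted_coefs big_ord_recl big1 => [|i _].
    by rewrite coef1 mul1r addr0.
  by rewrite coef1 mul0r.
rewrite fair_bitXS weighted_coefsD !weighted_coefsZ weighted_coefsXM.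
have /andP[a b] := IHs N.+1 g g01.
have /andP[a' b'] := IHs N (g \o succn) (fun k => g01 k.+1).
by apply/andP; split; lra.
Qed.

Lemma weighted_coefs_XfairX {F : realFieldType} s N (g : nat -> F) :
  (forall k, 0 <= g k <= 1) ->
  0 <= weighted_coefs N g ('X * fair_bit ^+ s) <= 1.
Proof.
case: N => [|N] g01; first by rewrite weighted_coefs0n lexx ler01.
by rewrite weighted_coefsXM; apply: weighted_coefs_fair_bitX => k; apply: g01.
Qed.

(** At [s.+1] the two generating functions differ by [(1 - X^2) / 2] times [fair_bit ^+ s], hence by
    at most 1/2 in total variation; [0 ^+ s] singles out [s = 0], where the bound is 1. *)
Lemma shift_close_fair_bit_tv {F : realFieldType} s :
  shift_close (1 : F) (2^-1 * 0 ^+ s + 2^-1) (fair_bit ^+ s).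
Proof.
move=> N g g01; rewrite !mul1r.
have /andP[a b] := weighted_coefs_fair_bitX s N g g01.
have /andP[a' b'] := weighted_coefs_XfairX s N g g01.
case: s => [|s] in a b a' b' *; first by rewrite expr0; split; lra.
rewrite fair_bitXS mulrDr -!scalerAr !weighted_coefsD !weighted_coefsZ.
have /andP[c d] := weighted_coefs_fair_bitX s N g g01.
have : 0 <= weighted_coefs N g ('X * ('X * fair_bit ^+ s)) <= 1.
  case: N {a b a' b' c d} => [|N]; first by rewrite weighted_coefs0n lexx ler01.
  by rewrite weighted_coefsXM; apply: weighted_coefs_XfairX => k; apply: g01.
move=> /andP[e f]; rewrite expr0n /=.
by split; lra.
Qed.

Lemma coef_fair_bitX {F : realFieldType} s k :
  (fair_bit ^+ s : {poly F})`_k = 2^-1 ^+ s * 'C(s, k)%:R.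
Proof.
rewrite /fair_bit exprZn coefZ exprDn coef_sum; congr (_ * _).
have [ks|sk] := ltnP k s.+1; last first.
  rewrite bin_small // big1 // => i _.
  rewrite expr1n mul1r coefMn coefXn.
  by rewrite gtn_eqF ?mul0rn // (leq_trans (ltn_ord i)).
rewrite (bigD1 (Ordinal ks)) //= big1 ?addr0 => [|i ik].
  by rewrite expr1n mul1r coefMn coefXn eqxx.
rewrite expr1n mul1r coefMn coefXn.
by case: eqP => [e|_]; [case/eqP: ik; apply/val_inj|rewrite mul0rn].
Qed.

(* The likelihood ratio ['C(s, k.+1) / 'C(s, k)] exceeds [c] only if
   [(1 + c) * k.+1 <= s.+1], where the Chernoff weight [w] is at least 1. *)
Lemma bin_ratio_tail {F : realFieldType} (c : F) (w : nat -> F) s k :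
  0 < c -> (forall j, 0 <= w j) ->
  (forall j, (1 + c) * j%:R <= s.+1%:R -> 1 <= w j) ->
  'C(s, k.+1)%:R - c * 'C(s, k)%:R <= 'C(s, k.+1)%:R * w k.+1.
Proof.
move=> c0 w0 w1.
have C0 m j : 0 <= 'C(m, j)%:R :> F by exact: ler0n.
have [/w1 w1k|kc] := lerP ((1 + c) * k.+1%:R) s.+1%:R.
  by have := ler_wpM2l (C0 s k.+1) w1k; have := mulr_ge0 (ltW c0) (C0 s k); lra.
have cw0 : 0 <= 'C(s, k.+1)%:R * w k.+1 by exact: mulr_ge0.
suff : 'C(s, k.+1)%:R <= c * 'C(s, k)%:R by lra.
have [sk|ks] := ltnP s k.
  by rewrite bin_small ?mulr_ge0 // ?ltW // ltnW.
(* As [k.+1 * 'C(s, k.+1) = (s - k) * 'C(s, k)], it is enough that [s - k <= c * k.+1], which is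
   [kc]. *)
rewrite -(ler_pM2l (ltr0Sn F k)) -natrM mul_bin_left natrM natrB //.
rewrite mulrCA mulrA ler_wpM2r //.
move: kc; rewrite -!natr1; lra.
Qed.

(** The excess over [c] times the translate lives where the weight [u ^+ s.+1 * v ^+ k] is at least
    1, so the mean of this weight bounds it; the binomial theorem evaluates that mean. *)
Lemma shift_close_fair_bit {F : realFieldType} (c u v : F) s :
  0 < c -> 0 <= u -> 0 <= v ->
  (forall k, (1 + c) * k%:R <= s.+1%:R -> 1 <= u ^+ s.+1 * v ^+ k) ->
  shift_close c (u * (2^-1 * (u + u * v)) ^+ s) (fair_bit ^+ s).
Proof.
move=> c0 u0 v0 w1 N g g01.
pose w k := u ^+ s.+1 * v ^+ k.
have wE k : w k = u ^+ s.+1 * v ^+ k by [].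
have w0 k : 0 <= w k by rewrite wE mulr_ge0 ?exprn_ge0.
clearbody w.
have {}w1 k : (1 + c) * k%:R <= s.+1%:R -> 1 <= w k by rewrite wE; apply: w1.
have h0 : 0 <= 2^-1 ^+ s :> F by rewrite exprn_ge0 // invr_ge0.
have C0 m j : 0 <= 'C(m, j)%:R :> F by exact: ler0n.
have boundE : \sum_(k < s.+1) 2^-1 ^+ s * ('C(s, k)%:R * w k) =
    u * (2^-1 * (u + u * v)) ^+ s.
  rewrite -mulr_sumr -[u + _]/(u + _) -{2}[u]mulr1 -mulrDr !exprMn exprDn.
  rewrite !mulr_sumr; apply: eq_bigr => k _.
  by rewrite wE exprS expr1n mul1r -mulr_natr; ring.
have sum_le (f : nat -> F) M : (forall k, 0 <= f k) ->
    (forall k, (s < k)%N -> f k = 0) ->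
    \sum_(k < M) f k <= \sum_(k < s.+1) f k.
  move=> f0 fs; rewrite -!(big_mkord xpredT).
  have [Ms|sM] := leqP M s.+1.
    rewrite [leRHS](big_cat_nat (leq0n M) Ms) /= lerDl.
    by apply: sumr_ge0.
  rewrite (big_cat_nat (leq0n s.+1) (ltnW sM)) /= gerDl big_nat_cond big1 //.
  by move=> k /andP[/andP[sk _] _]; apply: fs.
have gle (x b : F) k : 0 <= b -> x <= b -> x * g k <= b.
  move=> b0 xb; have /andP[gk0 gk1] := g01 k.
  apply: le_trans (ler_wpM2r gk0 xb) _.
  by rewrite -[leRHS]mulr1 ler_wpM2l.
(* The translate has no mass at 0, so there the excess is the whole coefficient. *)
have tail0 : 'C(s, 0)%:R <= 'C(s, 0)%:R * w 0%N.
  by rewrite -[leLHS]mulr1 ler_wpM2l // w1 // mulr0.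
have tail k : 'C(s, k.+1)%:R - c * 'C(s, k)%:R <= 'C(s, k.+1)%:R * w k.+1.
  exact: bin_ratio_tail.
rewrite -!lerBlDl -!boundE /weighted_coefs !mulr_sumr -!sumrB; split.
  apply: le_trans (sum_le (fun k => 2^-1 ^+ s * ('C(s, k)%:R * w k)) N _ _).
  - apply: ler_sum => k _; rewrite mulrA -mulrBl; apply: gle.
      by rewrite !mulr_ge0.
    case: (k : nat) => [|j]; rewrite coefXM !coef_fair_bitX /=.
      by rewrite mulr0 subr0 ler_wpM2l.
    by rewrite mulrCA -mulrBr ler_wpM2l.
  - by move=> k; rewrite !mulr_ge0.
  - by move=> k sk; rewrite bin_small // mul0r mulr0.
case: N => [|N]; first by rewrite big_ord0 sumr_ge0 // => k _; rewrite !mulr_ge0.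
(* The symmetry [k -> s - k] of the binomial reduces the reverse direction to the same tail. *)
rewrite [leRHS](reindex_inj rev_ord_inj) /=.
pose f k := 2^-1 ^+ s * ('C(s, k)%:R * w (s - k)%N).
have -> : \sum_(k < s.+1) 2^-1 ^+ s * ('C(s, s.+1 - k.+1)%:R * w (s.+1 - k.+1)%N)
    = \sum_(k < s.+1) f k.
  by apply: eq_bigr => k _; rewrite subSS bin_sub // -ltnS.
apply: le_trans (sum_le f N _ _).
- rewrite big_ord_recl coefXM mul0r sub0r coef_fair_bitX.
  have /andP[g0 _] := g01 0%N.
  rewrite -[leRHS]add0r; apply: lerD.
    by rewrite oppr_le0 (mulr_ge0 (ltW c0)) ?mulr_ge0.
  apply: ler_sum => k _; rewrite mulrA -mulrBl; apply: gle.
    by rewrite !mulr_ge0.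
  rewrite coefXM !coef_fair_bitX /= /bump add1n mulrCA -mulrBr ler_wpM2l //.
  have [sk|ks|ks] := ltngtP s k.
  + by rewrite !bin_small ?mulr0 ?subr0 ?mul0r // ltnW.
  + have := tail (s - k.+1)%N; rewrite subnSK // !bin_sub //; exact: ltnW.
  + by rewrite -ks subnn binn bin_small // mulr0 subr0; rewrite bin0 in tail0.
- by move=> k; rewrite !mulr_ge0.
- by move=> k sk; rewrite /f bin_small // mul0r mulr0.
Qed.

(** * From shuffled events to the number of ones *)

Lemma weighted_coefs_sum {F : realFieldType} (I : finType) N (g : nat -> F)
    (P : I -> {poly F}) :
  weighted_coefs N g (\sum_i P i) = \sum_i weighted_coefs N g (P i).
Proof.
rewrite exchange_big; apply: eq_bigr => k _.
by rewrite coef_sum mulr_suml.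
Qed.

Lemma weighted_coefsXn {F : realFieldType} N (g : nat -> F) k :
  (k < N)%N -> weighted_coefs N g 'X^k = g k.
Proof.
move=> kN; rewrite /weighted_coefs (bigD1 (Ordinal kN)) //= big1 => [|i ik].
  by rewrite coefXn eqxx mul1r addr0.
by rewrite coefXn -val_eqE /= in ik *; rewrite (negPf ik) mul0r.
Qed.

Lemma perm_eq_bool (s1 s2 : seq bool) :
  size s1 = size s2 -> count id s1 = count id s2 -> perm_eq s1 s2.
Proof.
move=> size12 count12.
have count12N : count (predC id) s1 = count (predC id) s2.
  by apply: (@addnI (count id s1)); rewrite {2}count12 !count_predC.
have predT : pred1 true =1 id by case.
have predF : pred1 false =1 predC id by case.
by apply/allP => -[] _ /=; apply/eqP; rewrite ?(eq_count predT) ?(eq_count predF).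
Qed.

Lemma sum_ltn_ord n k : (k <= n)%N -> (\sum_(i < n) (i < k) = k)%N.
Proof.
move=> kn; rewrite -[RHS]card_ord -sum1_card (big_ord_widen _ (fun=> 1%N) kn).
by rewrite [RHS]big_mkcond; apply: eq_bigr => i _; case: ifP.
Qed.

Lemma count_mktuple n (f : 'I_n -> bool) :
  count id [tuple f i | i < n] = (\sum_i f i)%N.
Proof.
rewrite -sum1_count big_tuple big_mkcond; apply: eq_bigr => i _.
by rewrite tnth_mktuple; case: (f i).
Qed.

(** The number of ones is a complete invariant of bit vectors up to permutation; the representative
    puts the ones first. *)
Lemma ffun_bool_sorted {n} (y : {ffun 'I_n -> bool}) :
  exists t : 'S_n, y = [ffun i => (t i < \sum_j y j)%N].
Proof.
pose z : 'I_n -> bool := fun i => (i < \sum_j y j)%N.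
have : perm_eq [tuple y i | i < n] [tuple z i | i < n].
  apply: perm_eq_bool; rewrite ?size_tuple // !count_mktuple.
  rewrite sum_ltn_ord // -[leqRHS]card_ord -sum1_card.
  by apply: leq_sum => i _; case: (y i).
move=> /tuple_permP[t yz]; exists t; apply/ffunP => i; rewrite ffunE.
have {}yz : [tuple y i | i < n] = [tuple tnth [tuple z i | i < n] (t i) | i < n].
  exact: val_inj.
by have := congr1 (fun w => tnth w i) yz; rewrite !tnth_mktuple.
Qed.

(** The probability that the shuffler, fed with the fixed messages [y], outputs an element of [T];
    message [i] lands at position [s i], whence the inverse. *)
Definition shuffle_avg {F : realFieldType} {n} (T : {set {ffun 'I_n -> bool}})
    (y : {ffun 'I_n -> bool}) : F :=
  (n`!%:R)^-1 * \sum_(s : 'S_n) ([ffun j => y ((s^-1)%g j)] \in T)%:R.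

Lemma shuffle_avg01 {F : realFieldType} {n} (T : {set {ffun 'I_n -> bool}}) y :
  0 <= (shuffle_avg T y : F) <= 1.
Proof.
have n0 : 0 < n`!%:R :> F by rewrite ltr0n fact_gt0.
apply/andP; split.
  by rewrite mulr_ge0 ?invr_ge0 ?ler0n // sumr_ge0 // => s _; rewrite ler0n.
rewrite /shuffle_avg mulrC ler_pdivrMr // mul1r -card_Sn -sum1_card natr_sum.
by apply: ler_sum => s _; case: (_ \in _); rewrite ?lexx ?ler01.
Qed.

Lemma shuffle_avg_perm {F : realFieldType} {n} (T : {set {ffun 'I_n -> bool}})
    (y : {ffun 'I_n -> bool}) (t : 'S_n) :
  shuffle_avg T [ffun i => y (t i)] = (shuffle_avg T y : F).
Proof.
congr (_ * _); rewrite (reindex_inj (mulgI t)) /=; apply: eq_bigr => s _.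
congr ((_ \in T)%:R); apply/ffunP => j.
by rewrite !ffunE invMg permM permKV.
Qed.

Lemma prob_event_shuffle_avg n lam (X : {ffun 'I_n -> bool}) T :
  prob_event lam X T =
  \sum_(y : {ffun 'I_n -> bool})
    (\prod_i msg_prob n lam (X i) (y i)) * shuffle_avg T y.
Proof.
rewrite /prob_event /shuffled_bitsum_prob; under eq_bigr do rewrite RmultE.
rewrite -mulr_sumr exchange_big /=.
rewrite /shuffle_avg; under [RHS]eq_bigr do rewrite mulrCA mulr_sumr.
rewrite -mulr_sumr [in RHS]exchange_big /=; congr (_ * _).
apply: eq_bigr => s _.
pose h (y : {ffun 'I_n -> bool}) := [ffun j => y ((s^-1)%g j)].
have h_inj : injective h.
  move=> y z /ffunP yz; apply/ffunP => i.
  by have := yz (s i); rewrite !ffunE permK.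
rewrite (reindex_inj h_inj) big_mkcond /=; apply: eq_bigr => y _.
rewrite -/(h y); case: ifP => _; rewrite ?mulr0 // mulr1.
by apply: eq_bigr => i _; rewrite ffunE permK.
Qed.

Lemma msg_probE n (lam : R) x y :
  msg_prob n lam x y = (1 - lam / n%:R) * (y == x)%:R + lam / n%:R / 2.
Proof. by rewrite /msg_prob !RealsE. Qed.

Lemma msg_polyE n lam x :
  msg_poly (1 - lam / n%:R) x = \sum_b msg_prob n lam x b *: 'X^b.
Proof.
rewrite big_bool /msg_poly /fair_bit !msg_probE subKr.
rewrite scalerA scalerDr.
case: x; rewrite /= ?mulr1 ?mulr0 ?add0r [(_ + _ / 2) *: _]scalerDl.
  by rewrite expr1 [_ *: 1 + _]addrC addrA.
by rewrite expr0 addrA addrC.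
Qed.

(** [g k] is the shuffle average at the sorted vector with [k] ones. It depends on [T] alone, so
    both neighbours are tested against the same [g]. *)
Lemma prob_event_genfun n (T : {set {ffun 'I_n -> bool}}) :
  exists2 g : nat -> R, forall k, 0 <= g k <= 1 &
  forall lam X, prob_event lam X T =
    weighted_coefs n.+1 g (\prod_i msg_poly (1 - lam / n%:R) (X i)).
Proof.
pose g k : R := shuffle_avg T [ffun i : 'I_n => (i < k)%N].
exists g => [k|lam X]; first exact: shuffle_avg01.
under [in RHS]eq_bigr do rewrite msg_polyE.
rewrite bigA_distr_bigA weighted_coefs_sum prob_event_shuffle_avg.
apply: eq_bigr => y _; rewrite scaler_prod weighted_coefsZ; congr (_ * _).
rewrite prodrXr weighted_coefsXn; last first.
  rewrite ltnS -[leqRHS]card_ord -sum1_card.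
  by apply: leq_sum => i _; case: (y i).
have [t yE] := ffun_bool_sorted y.
rewrite [LHS](congr1 _ yE) -[RHS](shuffle_avg_perm T _ t).
by congr (shuffle_avg T _); apply/ffunP => i; rewrite !ffunE.
Qed.

(** * Amplification by the differing user *)

Lemma weighted_coefs_msg_polyM {F : realFieldType} N (g : nat -> F) (q : F) x P :
  weighted_coefs N g (msg_poly q x * P) =
    q * weighted_coefs N g (if x then 'X * P else P) +
    (1 - q) / 2 * (weighted_coefs N g P + weighted_coefs N g ('X * P)).
Proof.
rewrite mulrDl -!scalerAl mulrDl mul1r !(weighted_coefsD, weighted_coefsZ) mulrA.
by case: x; rewrite /= ?expr1 ?expr0 ?mul1r.
Qed.

Lemma msg_poly_coef_ge0 {F : realFieldType} (q : F) x k :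
  0 <= q <= 1 -> 0 <= (msg_poly q x)`_k.
Proof.
move=> /andP[q0 q1].
rewrite coefD !coefZ coefXn coefD coef1 coefX.
apply: addr_ge0; first by rewrite mulr_ge0 ?ler0n.
by rewrite mulr_ge0 ?subr_ge0 // mulr_ge0 ?invr_ge0 ?addr_ge0 ?ler0n.
Qed.

Lemma coef_prod_msg_poly_ge0 {F : realFieldType} (q : F) (xs : seq bool) k :
  0 <= q <= 1 -> 0 <= (\prod_(x <- xs) msg_poly q x)`_k.
Proof.
move=> q01; elim: xs k => [|x xs IHxs] k.
  by rewrite big_nil coef1 ler0n.
rewrite big_cons coefM sumr_ge0 // => i _.
by rewrite mulr_ge0 ?IHxs ?msg_poly_coef_ge0.
Qed.

(* The differing user's message is itself a mixture: only with probability [q]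
   does it reveal the input, which turns the slack [a] and the failure [B] of
   the other users' messages into [2 * q * a] and [q * B]. *)
Lemma msg_poly_amplification {F : realFieldType} (a B q : F) (xs : seq bool) N g
    (x x' : bool) :
  0 <= q <= 1 -> 0 <= a -> 0 <= B -> (forall k, 0 <= g k <= 1) ->
  let Q := \prod_(y <- xs) msg_poly q y in
  shift_close (1 + a) B Q ->
  weighted_coefs N g (msg_poly q x * Q) <=
    (1 + 2 * q * a) * weighted_coefs N g (msg_poly q x' * Q) + q * B.
Proof.
move=> q01 a0 B0 g01 Q closeQ; rewrite !weighted_coefs_msg_polyM.
have [h1 h2] := closeQ N g g01.
have Q_ge0 k : 0 <= Q`_k by exact: coef_prod_msg_poly_ge0.
have P0 : 0 <= weighted_coefs N g Q by exact: weighted_coefs_ge0.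
have P1 : 0 <= weighted_coefs N g ('X * Q).
  by apply: weighted_coefs_ge0 => // k; rewrite coefXM; case: ifP.
have /andP[q0 q1] := q01; clear -h1 h2 P0 P1 q0 q1 a0 B0.
rewrite ![weighted_coefs N g (if _ then _ else _)]fun_if.
move: (weighted_coefs N g Q) (weighted_coefs N g ('X * Q)) h1 h2 P0 P1.
move=> y z h1 h2 P0 P1.
have qB : 0 <= q * B by exact: mulr_ge0.
have qa : 0 <= q * a by exact: mulr_ge0.
have q'0 : 0 <= 1 - q by lra.
have qqa : 0 <= q * a * (1 - q) by exact: mulr_ge0.
(* The factor 2 arises here: the weight under [x'] is at least half of [y] if [x'] is false, and
   half of [z] if it is true. *)
have := mulr_ge0 qqa P0; have := mulr_ge0 qqa P1.
have := mulr_ge0 qa P0; have := mulr_ge0 qa P1.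
have := mulr_ge0 (mulr_ge0 qa q0) P0; have := mulr_ge0 (mulr_ge0 qa q0) P1.
have := ler_wpM2l q0 h1; have := ler_wpM2l q0 h2.
by case: x; case: x' => /=; lra.
Qed.

Lemma exp_ge1Dx (x : R) : 1 + x <= exp x.
Proof. exact/RleP/exp_ineq1_le. Qed.

Lemma exp_gt0 (x : R) : 0 < exp x.
Proof. exact/RltP/exp_pos. Qed.

Lemma prob_event_ge0 n (lam : R) (X : {ffun 'I_n -> bool}) T :
  0 <= lam -> lam <= n%:R -> 0 <= prob_event lam X T.
Proof.
move=> lam0 lamn; have p0 : 0 <= lam / n%:R by rewrite divr_ge0.
have p1 : lam / n%:R <= 1.
  (* For [n = 0] the quotient is 0, the inverse of 0 being 0. *)
  have [n0|n_neq0] := eqVneq (n%:R : R) 0; first by rewrite n0 invr0 mulr0 ler01.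
  by rewrite ler_pdivrMr ?mul1r // lt_def n_neq0 ler0n.
apply: sumr_ge0 => z _; rewrite mulr_ge0 ?invr_ge0 ?ler0n //.
apply: sumr_ge0 => s _; apply: prodr_ge0 => i _; rewrite msg_probE.
apply: addr_ge0; first by rewrite mulr_ge0 ?ler0n ?subr_ge0.
by rewrite mulr_ge0 ?invr_ge0 ?ler0n.
Qed.

Lemma bitsum_DP_of_shift_close n (lam eps delta a B : R) :
  let q := 1 - lam / n%:R in
  0 <= lam -> lam <= n%:R -> (0 < n)%N -> 0 <= a -> 0 <= B ->
  (forall xs : seq bool, size xs = n.-1 ->
     shift_close (1 + a) B (\prod_(x <- xs) msg_poly q x)) ->
  2 * q * a <= eps -> q * B <= delta ->
  bitsum_shuffled_DP n lam eps delta.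
Proof.
move=> q lam0 lamn n_gt0 a0 B0 closeQ qa qB X X' nbXX' T.
have n0 : 0 < n%:R :> R by rewrite ltr0n.
have p0 : 0 <= lam / n%:R by rewrite divr_ge0 // ltW.
have p1 : lam / n%:R <= 1 by rewrite ler_pdivrMr ?mul1r.
have q01 : 0 <= q <= 1 by rewrite /q; apply/andP; split; lra.
have PX'_ge0 := prob_event_ge0 n lam X' T lam0 lamn.
have slack0 : 0 <= 2 * q * a.
  by rewrite !mulr_ge0 ?ler0n //; case/andP: q01.
have qB0 : 0 <= q * B by rewrite mulr_ge0 //; case/andP: q01.
suff PX : prob_event lam X T <= (1 + 2 * q * a) * prob_event lam X' T + q * B.
  apply: (le_trans PX); apply: lerD => //; apply: ler_wpM2r => //.
  by apply: le_trans (exp_ge1Dx eps); rewrite lerD2l.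
have [i /eqP Xi|XX'] := pickP (fun i => X i != X' i); last first.
  have -> : X = X' by apply/ffunP => i; apply/eqP/negbFE/XX'.
  rewrite mulrDl mul1r -addrA lerDl addr_ge0 // mulr_ge0 //.
have XX' j : j != i -> X' j = X j.
  move=> ji; apply/esym/eqP/negPn; apply: contra ji => Xj.
  by apply/eqP/(card_le1_eqP nbXX'); rewrite inE //; apply/eqP.
have [g g01 gE] := prob_event_genfun n T.
pose xs := [seq X j | j <- enum (predC1 i)].
have size_xs : size xs = n.-1 by rewrite size_map -cardE cardC1 card_ord.
have prodE Y : (forall j, j != i -> Y j = X j) ->
    \prod_j msg_poly q (Y j) = msg_poly q (Y i) * \prod_(x <- xs) msg_poly q x.
  move=> YX; rewrite (bigD1 i) //= big_map big_enum; congr (_ * _).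
  by apply: eq_bigr => j ji; rewrite YX.
rewrite !gE -/q !prodE //.
by apply: msg_poly_amplification => //; apply: closeQ.
Qed.

Lemma shift_close_le {F : realFieldType} (c B B' : F) P :
  B <= B' -> shift_close c B P -> shift_close c B' P.
Proof.
move=> BB' cP N g g01; have [h1 h2] := cP N g g01.
by split; [apply: le_trans h1 _|apply: le_trans h2 _]; rewrite lerD2l.
Qed.

Lemma shift_close_prod {F : realFieldType} (c A t B q : F) (xs : seq bool) :
  0 <= q <= 1 ->
  (forall s, shift_close c (A * t ^+ s + B) (fair_bit ^+ s)) ->
  shift_close c (A * (q + (1 - q) * t) ^+ size xs + B)
    (\prod_(x <- xs) msg_poly q x).
Proof.
move=> q01 /shift_close_msgs - /(_ q xs q01 0%N).
by rewrite !expr0 !mulr1.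
Qed.

(** * Exponential estimates and the Chernoff tail *)

(* Stdlib would otherwise parse the argument of [exp] with [Rplus], [Rmult]... *)
Local Arguments exp x%_ring_scope.

Lemma exp_mulD (x y : R) : exp x * exp y = exp (x + y).
Proof. exact: expRD. Qed.

Lemma exp_mulN (x : R) : exp x * exp (- x) = 1.
Proof. by rewrite exp_mulD subrr expR0. Qed.

Lemma ler_exp (x y : R) : x <= y -> exp x <= exp y.
Proof.
move=> xy; have -> : y = x + (y - x) by ring.
rewrite -[leRHS]exp_mulD -[leLHS]mulr1 (ler_wpM2l (ltW (exp_gt0 x))) //.
by apply: le_trans (exp_ge1Dx _); lra.
Qed.

(** From [exp (- x) >= 1 - x] and [(1 - x) * (1 + x + 2 * x^2) = 1 + x^2 * (1 - 2 * x)]. *)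
Lemma exp_le_quad (x : R) : 0 <= x -> x <= 2^-1 -> exp x <= 1 + x + 2 * x ^+ 2.
Proof.
move=> x0 x1; have := exp_ge1Dx (- x)%R.
have := exp_mulN x; move: (exp (- x)) (exp_gt0 x) => w.
move: (exp x) => e e0 ew w1.
have h : e * (1 - x) <= 1 by rewrite -[leRHS]ew (ler_wpM2l (ltW e0)).
rewrite -(@ler_pM2r _ (1 - x)); last by lra.
apply: (le_trans h).
have := mulr_ge0 (sqr_ge0 x) (_ : 0 <= 1 - 2 * x).
by move=> /(_ ltac:(lra)); lra.
Qed.

(** From [exp y >= 1 + y] and [(1 + y) * (1 - y + y^2) = 1 + y^3]. *)
Lemma expN_le_quad (y : R) : 0 <= y -> exp (- y) <= 1 - y + y ^+ 2.
Proof.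
move=> y0; have := exp_ge1Dx y.
have := exp_mulN y; move: (exp (- y)) (exp_gt0 (- y)%R) (exp y) => w w0 e ew e1.
have h : (1 + y) * w <= 1 by rewrite -[leRHS]ew (ler_wpM2r (ltW w0)).
rewrite -(@ler_pM2l _ (1 + y)); last by lra.
apply: (le_trans h).
have := exprn_ge0 3 y0.
by lra.
Qed.

(* The Chernoff weight is [exp (h * (s.+1 - (2 + a) * k))] with [h = a / 12]. *)
Lemma shift_close_fair_bit_chernoff (a : R) s : 0 <= a -> a <= 1 ->
  shift_close (1 + a) (exp 1 * (1 - a ^+ 2 / 50) ^+ s) (fair_bit ^+ s).
Proof.
move=> a0 a1; pose h := a / 12; pose v := exp (- (h * (2 + a))).
have h0 : 0 <= h by rewrite /h; lra.
have h1 : h <= 2^-1 by rewrite /h; lra.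
have v0 : 0 <= v by exact/ltW/exp_gt0.
have u0 : 0 <= exp h by exact/ltW/exp_gt0.
have uvE : exp h * v = exp (- (h * (1 + a))).
  by rewrite /v exp_mulD; congr exp; ring.
have base : 0 <= 2^-1 * (exp h + exp h * v).
  by rewrite mulr_ge0 ?invr_ge0 ?ler0n ?addr_ge0 // mulr_ge0.
(* To second order the sum of the two exponentials is at most [2 - h * a + h^2 * (2 + (1 + a)^2)],
   whose last factor is at most 6; with [h = a / 12] the average is at most [1 - a^2 / 48]. *)
have mgf : 2^-1 * (exp h + exp h * v) <= 1 - a ^+ 2 / 50.
  rewrite uvE; have hx := exp_le_quad h h0 h1.
  have ha0 : 0 <= h * (1 + a) by rewrite mulr_ge0 //; lra.
  have := expN_le_quad _ ha0; move: hx.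
  move: (exp h) (exp (- (h * (1 + a)))) => e w.
  have a'0 : 0 <= 1 - a by lra.
  have a3 : 0 <= 3 + a by lra.
  have := mulr_ge0 (mulr_ge0 (sqr_ge0 a) a'0) a3; have := sqr_ge0 a.
  rewrite /h; lra.
apply: (shift_close_le _ (exp h * (2^-1 * (exp h + exp h * v)) ^+ s)).
  apply: ler_pM => //; first by rewrite exprn_ge0.
    by apply: ler_exp; lra.
  by rewrite lerXn2r // nnegrE // (le_trans base).
apply: shift_close_fair_bit => //; first by lra.
move=> k hk; rewrite /v !expRX exp_mulD; apply: le_trans (exp_ge1Dx _).
rewrite lerDl mulNrn -[h *+ _]mulr_natr -[_ * _ *+ k]mulr_natr.
have := ler_wpM2l h0 hk.
by lra.
Qed.

(** * Sufficient conditions for privacy *)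

(** Slack [a = 0] and [t = 0]: the average of [0 ^+ s] is [q ^+ n.-1], the chance that no other user
    randomises. *)
Lemma bitsum_DP_tv n (lam eps delta : R) :
  let q := 1 - lam / n%:R in
  0 <= lam -> lam <= n%:R -> (0 < n)%N -> 0 <= eps ->
  q * (2^-1 * q ^+ n.-1 + 2^-1) <= delta ->
  bitsum_shuffled_DP n lam eps delta.
Proof.
move=> q lam0 lamn n_gt0 eps0 q_delta.
have n0 : 0 < n%:R :> R by rewrite ltr0n.
have p0 : 0 <= lam / n%:R by rewrite divr_ge0 // ltW.
have p1 : lam / n%:R <= 1 by rewrite ler_pdivrMr ?mul1r.
have q01 : 0 <= q <= 1 by rewrite /q; apply/andP; split; lra.
pose B := 2^-1 * q ^+ n.-1 + 2^-1.
apply: (bitsum_DP_of_shift_close n lam eps delta 0 B) => //.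
- rewrite /B addr_ge0 ?mulr_ge0 ?exprn_ge0 ?invr_ge0 ?ler0n //.
  by case/andP: q01.
- move=> xs size_xs; rewrite /B -size_xs addr0 -/q.
  have -> : q ^+ size xs = (q + (1 - q) * 0) ^+ size xs by rewrite mulr0 addr0.
  exact: shift_close_prod q01 shift_close_fair_bit_tv.
- by rewrite mulr0.
Qed.

(** The averaged failure is [exp 1 * t ^+ n.-1] with [t <= exp (- y)] and
    [y = lam * a^2 / (50 * n)]. Since [n.-1 >= n / 2], the exponent reaches
    [lam * a^2 / 100 >= L + 1], and the extra 1 pays for the factor [exp 1]. *)
Lemma bitsum_DP_chernoff n (lam eps L a : R) :
  let q := 1 - lam / n%:R in
  0 <= lam -> lam <= n%:R -> (1 < n)%N -> 0 <= a -> a <= 1 ->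
  2 * q * a <= eps -> 100 * (L + 1) <= lam * a ^+ 2 ->
  bitsum_shuffled_DP n lam eps (exp (- L)).
Proof.
move=> q lam0 lamn n_gt1 a0 a1 qa hL.
have n0 : 0 < n%:R :> R by rewrite ltr0n ltnW.
have p0 : 0 <= lam / n%:R by rewrite divr_ge0 // ltW.
have p1 : lam / n%:R <= 1 by rewrite ler_pdivrMr ?mul1r.
have q01 : 0 <= q <= 1 by rewrite /q; apply/andP; split; lra.
pose t := q + (1 - q) * (1 - a ^+ 2 / 50).
have tE : t = 1 - lam / n%:R * a ^+ 2 / 50 by rewrite /t /q; ring.
have a2_le1 : a ^+ 2 <= 1 by rewrite expr_le1.
have a2_ge0 := sqr_ge0 a.
have t0 : 0 <= t.
  have : lam / n%:R * a ^+ 2 <= 1 by rewrite mulr_ile1.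
  by rewrite tE; lra.
pose B := exp 1 * t ^+ n.-1.
have B0 : 0 <= B by rewrite /B mulr_ge0 ?exprn_ge0 ?(ltW (exp_gt0 _)).
apply: (bitsum_DP_of_shift_close n lam eps (exp (- L)) a B) => //.
- exact: ltnW.
- move=> xs size_xs; rewrite /B -size_xs -/q -[exp 1 * _]addr0.
  apply: shift_close_prod q01 _ => s; rewrite addr0.
  exact: shift_close_fair_bit_chernoff.
have /andP[q0 q1] := q01.
apply: (@le_trans _ _ B).
  by rewrite -[leRHS]mul1r ler_wpM2r.
pose y := lam / n%:R * a ^+ 2 / 50.
have tn : t ^+ n.-1 <= exp (- y) ^+ n.-1.
  rewrite lerXn2r ?nnegrE ?(ltW (exp_gt0 _)) //.
  by rewrite tE; apply: le_trans (exp_ge1Dx _).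
apply: (le_trans (ler_wpM2l (ltW (exp_gt0 _)) tn)).
rewrite expRX exp_mulD; apply: ler_exp; rewrite mulNrn -[y *+ _]mulr_natr.
have n2 : n%:R <= 2 * n.-1%:R :> R.
  rewrite -natrM ler_nat mul2n -addnn -{1}(prednK (ltnW n_gt1)) -addn1 leq_add2l.
  by rewrite -ltnS prednK // ltnW.
have c0 : 0 <= lam * a ^+ 2 / n%:R by rewrite divr_ge0 ?mulr_ge0 // ltW.
have := ler_wpM2l c0 n2; rewrite divfK ?gt_eqF //.
rewrite /y; move: (n.-1%:R : R) (n%:R^-1 : R) => m w; lra.
Qed.

(** For small [L] the noise must be proportional to [L], which the term [L + 1] of the Chernoff
    criterion forbids. With [x = exp (- L)], [lam = 4 * L] gives [q ^+ n <= x^4], and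
    [(x^4 + 1) / 2 <= x] holds for [3 / 4 <= x <= 1]. *)
Lemma bitsum_DP_small n (L eps : R) :
  (0 < n)%N -> 0 <= L -> L <= 4^-1 -> 4 * L <= n%:R -> 0 <= eps ->
  bitsum_shuffled_DP n (4 * L)%R eps (exp (- L)).
Proof.
move=> n_gt0 L0 L1 Ln eps0.
have n0 : 0 < n%:R :> R by rewrite ltr0n.
apply: bitsum_DP_tv => //; first by rewrite mulr_ge0.
set q := 1 - _.
have q1 : q <= 1 by rewrite gerBl divr_ge0 ?mulr_ge0 // ltW.
have q0 : 0 <= q by rewrite subr_ge0 ler_pdivrMr ?mul1r.
have qn : q ^+ n <= exp (- L) ^+ 4.
  have qe : q <= exp (- (4 * L / n%:R)) by exact: exp_ge1Dx.
  apply: le_trans (_ : exp (- (4 * L / n%:R)) ^+ n <= _).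
    by rewrite lerXn2r ?nnegrE ?(ltW (exp_gt0 _)).
  rewrite !expRX; apply: ler_exp; rewrite !mulNrn -[_ / _ *+ n]mulr_natr.
  rewrite divfK ?gt_eqF //.
  by lra.
have x0 := exp_ge1Dx (- L)%R.
have x1 : exp (- L) <= exp 0 by apply: ler_exp; lra.
rewrite expR0 in x1.
move: (exp (- L)) x0 x1 qn => x x0 x1.
rewrite -{1}(prednK n_gt0) exprS => qn.
have x34 : 3 / 4 <= x by lra.
have : 0 <= (1 - x) * (x ^+ 3 + x ^+ 2 + x - 1).
  apply: mulr_ge0; first by lra.
  have : 0 <= x by lra.
  by move=> x_ge0; have := exprn_ge0 3 x_ge0; nra.
by lra.
Qed.

(** * Constants and choice of [lam] *)

Lemma exp_Nln (delta : R) : 0 < delta -> exp (- ln (1 / delta)) = delta.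
Proof.
move=> d0; have := exp_mulN (ln (1 / delta)).
rewrite exp_ln; last by apply/RltP; rewrite !RealsE mul1r invr_gt0.
by rewrite !RealsE mul1r => /(canRL (mulKf _)) ->;
  rewrite ?invrK ?mulr1 // invr_eq0 gt_eqF.
Qed.

Theorem theorem4p1 :
  exists k1 k2 k3 k4 k5 : R,
    0 < k1 /\ 0 < k2 /\ 0 < k3 /\ 0 < k4 /\ 0 < k5 /\
    forall (n : nat) (delta eps : R),
      (1 <= n)%N -> 0 < delta -> delta < 1 ->
      k2 * ln (1 / delta) / n%:R <= eps -> eps <= 1 ->
      exists lam : R,
        0 < lam /\ lam < n%:R /\
        bitsum_shuffled_DP n lam eps delta /\
        (sqrt (k3 * ln (1 / delta) / n%:R) <= eps ->
           lam <= k4 * ln (1 / delta) / eps ^+ 2) /\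
        (~ (sqrt (k3 * ln (1 / delta) / n%:R) <= eps) ->
           lam <= n%:R - k5 * eps * (n%:R * sqrt n%:R) / sqrt (ln (1 / delta))).
Proof.
(* With this [K], [K * L <= n] yields [a <= 1] for the slack [a = 100 * sL / sn] below, and failure
   of the threshold condition yields [q <= 1 / 2]. *)
pose K : R := (100 ^+ 2)%R.
have KE : K = 100 ^+ 2 by [].
have K0 : 0 < K by rewrite KE exprn_gt0.
exists 1%R, K, K, (20 * 100)%R, (200^-1)%R.
do 5![split; first by rewrite ?mulr_gt0 ?invr_gt0].
move=> n delta eps n_gt0 delta0 delta1.
rewrite !RsqrtE RdivE [Rmult K _]RmultE.
have := exp_Nln _ delta0; set L := ln _ => LE hK eps1.
have L0 : 0 < L.
  rewrite ltNge; apply/negP => L_le0; move: delta1; rewrite -LE ltNge => /negP; apply.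
  by apply: le_trans (exp_ge1Dx (- L)%R); lra.
have n0 : 0 < n%:R :> R by rewrite ltr0n.
have eps0 : 0 < eps.
  by apply: lt_le_trans hK; rewrite divr_gt0 ?mulr_gt0.
have KLn : K * L <= n%:R.
  by move: hK; rewrite ler_pdivrMr // => /le_trans; apply; rewrite ler_piMl // ltW.
have eps2_gt0 : 0 < eps ^+ 2 by rewrite exprn_gt0.
have eps2_le1 : eps ^+ 2 <= 1 by rewrite expr_le1 // ltW.
have condE : (Num.sqrt (K * L / n%:R) <= eps) = (K * L <= eps ^+ 2 * n%:R).
  have c0 : 0 <= K * L / n%:R by rewrite divr_ge0 ?mulr_ge0 // ltW.
  rewrite -ler_pdivrMr // -[in RHS](sqr_sqrtr c0).
  by rewrite ler_pXn2r // nnegrE ?sqrtr_ge0 // ltW.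
rewrite condE; have [cond|ncond] := leP (K * L) (eps ^+ 2 * n%:R).
  have [L_le|L_gt] := leP L 4^-1.
    have Ln : 4 * L < n%:R by move: KLn; rewrite KE; lra.
    exists (4 * L)%R; split; first by rewrite mulr_gt0.
    split=> //; split; last split=> // _.
      by rewrite -LE; apply: bitsum_DP_small; rewrite // ltW.
    by rewrite ler_pdivlMr //; nra.
  have n_gt1 : (1 < n)%N.
    by rewrite -(ltr_nat R); apply: lt_le_trans KLn; rewrite KE; lra.
  (* With slack [eps / 2] this gives [lam * a^2 = 500 * L], which exceeds [100 * (L + 1)] because
     [L > 1 / 4]. *)
  pose lam := 20 * 100 * L / eps ^+ 2.
  have lam0 : 0 < lam by rewrite divr_gt0 ?mulr_gt0.
  have lamn : lam < n%:R.
    by rewrite ltr_pdivrMr // [ltRHS]mulrC; apply: lt_le_trans cond; rewrite KE; lra.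
  exists lam; do 2![split=> //]; split; last by split.
  rewrite -LE; apply: (bitsum_DP_chernoff n lam eps L (eps / 2)%R) => //; try lra.
  - have p0 : 0 <= lam / n%:R by rewrite divr_ge0 // ltW.
    have := mulr_ge0 p0 (ltW eps0); lra.
  - rewrite expr_div_n mulrA divfK ?gt_eqF //; lra.
pose sn := Num.sqrt (n%:R : R); pose sL := Num.sqrt L.
have sn0 : 0 < sn by rewrite sqrtr_gt0.
have sL0 : 0 < sL by rewrite sqrtr_gt0.
have snE : sn ^+ 2 = n%:R by rewrite sqr_sqrtr // ltW.
have sLE : sL ^+ 2 = L by rewrite sqr_sqrtr // ltW.
(* The value for which [n * (1 - q)] equals the claimed bound on [lam]. *)
pose q := eps * sn / (200 * sL).
have qdef : q = eps * sn / (200 * sL) by [].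
have q0 : 0 < q by rewrite qdef divr_gt0 ?mulr_gt0.
have q_half : q <= 2^-1.
  rewrite qdef ler_pdivrMr ?mulr_gt0 //.
  have -> : 2^-1 * (200 * sL) = 100 * sL by lra.
  rewrite -(@ler_pXn2r _ 2) ?nnegrE ?mulr_ge0 ?(ltW eps0) ?(ltW sn0) ?(ltW sL0) //.
  by rewrite !exprMn snE sLE -KE ltW.
clearbody q.
have q_lt1 : q < 1 by apply: le_lt_trans q_half _; rewrite invf_lt1 // ltr1n.
pose lam := n%:R * (1 - q).
have qE : 1 - lam / n%:R = q by rewrite /lam mulrAC divff ?gt_eqF //; ring.
have lam0 : 0 < lam by rewrite mulr_gt0 // subr_gt0.
have lamn : lam < n%:R by rewrite -[ltRHS]mulr1 ltr_pM2l // gtrBl.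
exists lam; do 2![split=> //]; split; last first.
  split=> // _; rewrite /lam qdef -/sn -/sL mulrBr mulr1 lerD2l lerN2 invfM.
  by move: (sL^-1) => w; lra.
(* For small [L], the total variation bound is at most [q <= 1 / 2], below [1 - L <= delta]. *)
have [L_le|L_gt] := leP L 4^-1.
  apply: bitsum_DP_tv; rewrite ?(ltW lam0) ?(ltW lamn) ?(ltW eps0) // qE.
  have q1 : q ^+ n.-1 <= 1 by rewrite exprn_ile1 // ltW.
  have := ler_wpM2l (ltW q0) q1; have := exp_ge1Dx (- L)%R; rewrite LE; lra.
have n_gt1 : (1 < n)%N.
  by rewrite -(ltr_nat R); apply: lt_le_trans KLn; rewrite KE; lra.
(* The slack for which [2 * q * a = eps] exactly; it may exceed [eps] since [q] is small. *)
pose a := 100 * sL / sn.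
have a2E : a ^+ 2 = K * L / n%:R by rewrite /a expr_div_n exprMn snE sLE.
have a0 : 0 <= a by rewrite ltW // divr_gt0 ?mulr_gt0.
rewrite -LE; apply: (bitsum_DP_chernoff n lam eps L a) => //;
  rewrite ?(ltW lam0) ?(ltW lamn) //.
- by rewrite -(@expr_le1 _ 2) // a2E ler_pdivrMr ?mul1r.
- rewrite qE qdef /a le_eqVlt; apply/orP; left; apply/eqP; field.
  by rewrite !gt_eqF.
- have -> : lam * a ^+ 2 = (1 - q) * (K * L).
    by rewrite a2E /lam; field; rewrite gt_eqF.
  have := mulr_ge0 (ltW L0) (ltW q0); rewrite KE; nra.
Qed.
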